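(* Let $p$ be an odd prime and let $G=\langle a,b\mid a^{4p}=b^2=1,\ a^b=a^{-1}\rangle\cong\mathrm{D}_{8p}$. For $\pi\in\{0,1\}$ let $S_\pi=(a^\pi b)^G\cup\{a^i\mid \gcd(i,4p)=1\}$. Then $\mathrm{Cay}(G,S_\pi)$ is a connected arc-transitive inner-automorphic Cayley graph. Moreover, $\mathrm{Aut}(\mathrm{Cay}(G,S_\pi))\cong \mathbb{Z}_2^{4p}.(\mathrm{S}_{2p}\times\mathbb{Z}_2)$.
   Context: All graphs are finite, simple and undirected. $\mathrm{D}_{8p}$ is the dihedral group of order $8p$; $x^y=y^{-1}xy$ and $g^G$ is the conjugacy class of $g$ in $G$. For a finite group $G$ and $S\subseteq G\setminus\{1\}$ with $S=S^{-1}$, $\mathrm{Cay}(G,S)$ is the graph with vertex set $G$ in which $x,y$ are adjacent iff $yx^{-1}\in S$; it is inner-automorphic if $S$ is a union of conjugacy classes of $G$. A graph is arc-transitive if its full automorphism group is transitive on arcs (ordered pairs of adjacent vertices). $\mathrm{S}_m$ is the symmetric group of degree $m$, and $X.Y$ denotes an extension of $X$ by $Y$, i.e. a group with a normal subgroup isomorphic to $X$ whose quotient is isomorphic to $Y$. *)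

(* Defs.v *)
Set Warnings "-notation-overridden,-ambiguous-paths".
From mathcomp Require Import all_boot all_fingroup all_algebra all_solvable.

Set Implicit Arguments.
Unset Strict Implicit.
Unset Printing Implicit Defensive.

Import GroupScope.

(* A finite simple graph is given by its adjacency relation [e : rel T] on a
   finite vertex type [T], with [e] symmetric and irreflexive. *)

Definition connected_graph (T : finType) (e : rel T) : Prop :=
  forall x y : T, connect e x y.

Definition graph_aut (T : finType) (e : rel T) : {set {perm T}} :=
  [set s : {perm T} | [forall x, forall y, e (s x) (s y) == e x y]].

Lemma graph_autP (T : finType) (e : rel T) (s : {perm T}) :
  reflect (forall x y, e (s x) (s y) = e x y) (s \in graph_aut e).
Proof.
rewrite inE; apply: (iffP forallP) => [h x y | h x].
  by move/forallP/(_ y)/eqP: (h x).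
by apply/forallP => y; rewrite h.
Qed.

Lemma graph_aut_group_set (T : finType) (e : rel T) : group_set (graph_aut e).
Proof.
apply/group_setP; split=> [|s t /graph_autP hs /graph_autP ht].
  by apply/graph_autP => x y; rewrite !perm1.
by apply/graph_autP => x y; rewrite !permM ht hs.
Qed.

Canonical graph_aut_group (T : finType) (e : rel T) : {group {perm T}} :=
  Group (graph_aut_group_set e).

Definition arc_transitive (T : finType) (e : rel T) : Prop :=
  forall x y x' y' : T, e x y -> e x' y' ->
    exists2 s : {perm T}, s \in graph_aut e & s x = x' /\ s y = y'.

(* The finite group is the whole type [gT]. *)
Definition connection_set (gT : finGroupType) (S : {set gT}) : Prop :=
  1 \notin S /\ S^-1 = S.

Definition Cay (gT : finGroupType) (S : {set gT}) : rel gT :=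
  [rel x y | y * x^-1 \in S].

Lemma Cay_sym (gT : finGroupType) (S : {set gT}) :
  connection_set S -> symmetric (Cay S).
Proof.
by move=> [_ SV] x y; rewrite /Cay /= -{1}SV mem_invg invMg invgK.
Qed.

Lemma Cay_irrefl (gT : finGroupType) (S : {set gT}) :
  connection_set S -> irreflexive (Cay S).
Proof. by move=> [/negbTE S1 _] x; rewrite /Cay /= mulgV. Qed.

Definition inner_automorphic (gT : finGroupType) (S : {set gT}) : Prop :=
  exists2 C : {set {set gT}}, C \subset classes [set: gT] & S = cover C.

(* [E] is a group of the form X.Y *)
Definition is_extension (xT yT eT : finGroupType)
    (X : {group xT}) (Y : {group yT}) (E : {group eT}) : Prop :=
  exists N : {group eT}, [/\ N <| E, N \isog X & E / N \isog Y].

(* Exponents of [a] range over residues modulo [n]; this is all integer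
   exponents as soon as [a ^+ n = 1]. *)
Definition dihedral_connection_set (gT : finGroupType) (n : nat) (a b : gT)
    (pi : 'I_2) : {set gT} :=
  (a ^+ pi * b) ^: [set: gT]
    :|: [set a ^+ i | i : 'I_n & coprime i n].

(* Main.v *)
Require Import Defs.
From mathcomp Require Import all_boot all_fingroup all_algebra all_solvable.
From mathcomp Require Import zify.

Set Implicit Arguments.
Unset Strict Implicit.
Unset Printing Implicit Defensive.

Import GroupScope GRing.Theory.

(** Write a vertex of the Cayley graph as [a^i b^j], and put [S] for the
connection set.  Every element of [S] lies outside a subgroup of index 2,
namely the kernel of the parity character that is nontrivial on [a] and on
[a^pi b].  The nontrivial coset of that kernel has [4p] elements, and the only
ones missing from [S] are [a^p] and [a^-p], that is, the elements of that coset
in the normal cyclic subgroup [P] of order 4 generated by [a^p].  Hence two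
vertices are adjacent exactly when they have different parities and lie in
different cosets of [P].
There are [2p] cosets of [P], and each coset contains two vertices of each
parity.  So the graph is the crown graph (the complete bipartite graph with
parts of size [2p], minus a perfect matching) with each vertex replaced by two
nonadjacent twins.

In such a blown-up crown, a vertex has an index (here the coset of [P]), a side
(here the parity) and a level telling it from its twin, and adjacency means
distinct indices and distinct sides.  With at least three indices, having equal
sides and having equal indices are both expressible through adjacency alone
([same_side_common_neighbour], [same_index_nonadjacent]), so automorphisms
preserve both relations ([graph_aut_crown]) and permute the sides and the
indices.  Conversely any permutation of the indices, any translation of the
sides and any independent swapping of twins is an automorphism.  The swaps form
an elementary abelian normal subgroup of rank [4p], the permutations fixing all
levels form a complement isomorphic to [S_2p x Z_2], and the extension even
splits ([graph_aut_sdprod]).  Arc-transitivity follows from the 2-transitivity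
of the symmetric group on indices, twin swaps adjusting the levels.

On the dihedral side, [dih_adjacent] computes adjacency in terms of exponents,
and [coprime_difference] turns coprimality to [4p] into the two conditions on
parity and on residues modulo [p]. *)

(** * Blown-up crown graphs *)

Lemma Z2_neq (u v : 'Z_2) : u != v -> v = (u + 1)%R.
Proof.
by move: u v => [[|[|//]] hu] [[|[|//]] hv] // _; apply: val_inj.
Qed.

Lemma perm_2transitive (I : finType) (i j i' j' : I) :
  i != j -> i' != j' -> exists s : {perm I}, s i = i' /\ s j = j'.
Proof.
move=> ij ij'; exists (tperm i i' * tperm (tperm i i' j) j').
rewrite !permM !tpermL; split=> //; apply: tpermD.
  by rewrite -{2}(tpermL i i') (inj_eq perm_inj) eq_sym.
by rewrite eq_sym.
Qed.

Section BlownUpCrown.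

Variables (m : nat) (T : finType) (e : rel T).
(* Coordinates on the vertices: [w] is the index, [c] the side, [t] the level,
   and [g] rebuilds a vertex from them. *)
Variables (w : T -> 'I_m) (c t : T -> 'Z_2) (g : 'I_m -> 'Z_2 -> 'Z_2 -> T).
Hypothesis gK : forall x, g (w x) (c x) (t x) = x.
Hypothesis wg : forall i d u, w (g i d u) = i.
Hypothesis cg : forall i d u, c (g i d u) = d.
Hypothesis tg : forall i d u, t (g i d u) = u.
Hypothesis eE : forall x y, e x y = (w x != w y) && (c x != c y).

Lemma crown_coord_inj x y : w x = w y -> c x = c y -> t x = t y -> x = y.
Proof. by move=> ew ec et; rewrite -(gK x) ew ec et gK. Qed.

(** The general automorphism: the shift [v] of the level may depend on the index
and on the side, so that twins are swapped independently in each pair. *)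
Definition crown_move (s : 'S_m) (d : 'Z_2) (v : 'I_m -> 'Z_2 -> 'Z_2) x :=
  g (s (w x)) (c x + d)%R (t x + v (w x) (c x))%R.

Lemma crown_move_inj s d v : injective (crown_move s d v).
Proof.
move=> x y exy.
have ew : w x = w y.
  by apply: (@perm_inj _ s); move: (congr1 w exy); rewrite !wg.
have ec : c x = c y.
  by apply: (addIr d); move: (congr1 c exy); rewrite !cg.
apply: crown_coord_inj => //.
by move: (congr1 t exy); rewrite !tg ew ec => /addIr.
Qed.

Definition crown_perm s d v : {perm T} := perm (@crown_move_inj s d v).

Lemma crown_permE s d v x : crown_perm s d v x = crown_move s d v x.
Proof. exact: permE. Qed.

Lemma w_crown_perm s d v x : w (crown_perm s d v x) = s (w x).
Proof. by rewrite crown_permE wg. Qed.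

Lemma c_crown_perm s d v x : c (crown_perm s d v x) = (c x + d)%R.
Proof. by rewrite crown_permE cg. Qed.

Lemma t_crown_perm s d v x :
  t (crown_perm s d v x) = (t x + v (w x) (c x))%R.
Proof. by rewrite crown_permE tg. Qed.

Lemma crown_perm_aut s d v : crown_perm s d v \in graph_aut e.
Proof.
apply/graph_autP => x y; rewrite !eE !w_crown_perm !c_crown_perm.
by rewrite (inj_eq perm_inj) (inj_eq (addIr d)).
Qed.

(** The endpoints of an arc have distinct indices, so 2-transitivity on indices
moves them to any other such pair; a translation then corrects both sides at
once, because both arcs join opposite sides. *)
Lemma crown_arc_transitive : arc_transitive e.
Proof.
move=> x y x' y'; rewrite !eE => /andP[wxy cxy] /andP[wxy' cxy'].
have [s [sx sy]] := perm_2transitive wxy wxy'.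
pose d := (c x' - c x)%R.
(* The endpoints differ in index, so their levels are adjusted separately. *)
pose v i (_ : 'Z_2) := (if i == w x then t x' - t x else t y' - t y)%R.
exists (crown_perm s d v); first exact: crown_perm_aut.
split; apply: crown_coord_inj;
  rewrite ?w_crown_perm ?c_crown_perm ?t_crown_perm // /v ?eqxx.
- by rewrite addrC subrK.
- by rewrite addrC subrK.
- by rewrite (Z2_neq cxy) (Z2_neq cxy') /d addrAC [(c x + _)%R]addrC subrK.
- by rewrite eq_sym (negbTE wxy) addrC subrK.
Qed.

Hypothesis m_ge3 : 2 < m.

Lemma avoid_two (i j : 'I_m) : exists k : 'I_m, (k != i) && (k != j).
Proof.
have : 0 < #|~: [set i; j]|.
  by have := cardsC [set i; j]; rewrite card_ord cards2; lia.
by case/card_gt0P=> k; rewrite !inE negb_or; exists k.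
Qed.

(** A common neighbour is found on the other side, at an index avoiding both
given ones; this is where three indices are needed.  The point of the
characterization is that it mentions only adjacency. *)
Lemma same_side_common_neighbour x y :
  c x = c y <-> exists2 z, e x z & e y z.
Proof.
split=> [cxy | [z]].
  have [k /andP[kx ky]] := avoid_two (w x) (w y).
  have c1 : c x != (c x + 1)%R.
    by rewrite -{1}(addr0 (c x)) (inj_eq (addrI _)).
  by exists (g k (c x + 1)%R 0%R); rewrite !eE wg cg -?cxy eq_sym ?kx ?ky c1.
by rewrite !eE => /andP[_ /Z2_neq cx] /andP[_ /Z2_neq]; rewrite cx => /addIr.
Qed.

Lemma crown_connected : connected_graph e.
Proof.
have e_sym : symmetric e by move=> x y; rewrite !eE eq_sym [c x == _]eq_sym.
have same x y : c x = c y -> connect e x y.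
  move/same_side_common_neighbour=> [z xz yz].
  by apply: (connect_trans (connect1 xz)); rewrite connect1 // e_sym.
move=> x y; have [/same // | cxy] := eqVneq (c x) (c y).
have [k /andP[kx _]] := avoid_two (w x) (w x).
apply: (@connect_trans _ _ (g k (c y) 0%R)); last by apply: same; rewrite cg.
by rewrite connect1 // eE wg cg eq_sym kx.
Qed.

(** Across the two sides, nonadjacency is equality of indices.  Two vertices on
the same side have the same index exactly when some vertex [z] on the other
side is nonadjacent to both. *)
Lemma same_index_nonadjacent x y :
  w x = w y <->
  exists z, [/\ c z <> c x, ~~ e x z
              & if c x == c y then ~~ e y z else ~~ e x y].
Proof.
have far z u : c z <> c u -> ~~ e u z -> w u = w z.
  move/eqP=> czu; rewrite eE [c u == _]eq_sym czu andbT negbK.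
  by move/eqP.
split=> [wxy | [z [czx xz]]].
  exists (g (w x) (c x + 1)%R 0%R); rewrite !eE !wg cg -?wxy eqxx /=.
  split=> //; last by case: ifP.
  by move/eqP; rewrite -{2}(addr0 (c x)) (inj_eq (addrI _)).
have [cxy yz | cxy xy] := eqVneq (c x) (c y).
  by rewrite (far z x) // (far z y) // -cxy.
by rewrite (far y x) // => h; rewrite h eqxx in cxy.
Qed.

(** Sides and indices were both characterized by adjacency, hence their equality
is invariant under automorphisms. *)
Lemma graph_aut_crown (s : {perm T}) :
  s \in graph_aut e ->
  (forall x y, (c (s x) == c (s y)) = (c x == c y)) /\
  (forall x y, (w (s x) == w (s y)) = (w x == w y)).
Proof.
move/graph_autP=> es.
have cs x y : (c (s x) == c (s y)) = (c x == c y).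
  apply/eqP/eqP=> /same_side_common_neighbour[z xz yz];
    apply/same_side_common_neighbour.
    by exists (s^-1 z); rewrite -es permKV.
  by exists (s z); rewrite es.
split=> // x y; apply/eqP/eqP=> /same_index_nonadjacent[z [zx xz xyz]];
  apply/same_index_nonadjacent.
  exists (s^-1 z); rewrite -!(es _ (s^-1 z)) permKV; split=> //.
    by apply/eqP; rewrite -cs permKV; apply/eqP.
  by rewrite -cs -(es x y).
exists (s z); rewrite !es cs; split=> //.
by apply/eqP; rewrite cs; apply/eqP.
Qed.

Definition fibre_group : {set {perm T}} :=
  [set s : {perm T} | [forall x, (w (s x) == w x) && (c (s x) == c x)]].

Lemma fibre_groupP (s : {perm T}) :
  reflect (forall x, w (s x) = w x /\ c (s x) = c x) (s \in fibre_group).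
Proof.
rewrite inE; apply: (iffP forallP) => h x.
  by have /andP[/eqP ? /eqP ?] := h x.
by have [-> ->] := h x; rewrite !eqxx.
Qed.

Definition lift_base (sd : 'S_m * 'Z_2) : {perm T} :=
  crown_perm sd.1 sd.2 (fun _ _ => 0%R).

Lemma lift_baseM : {in [set: 'S_m * 'Z_2] &, {morph lift_base : x y / x * y}}.
Proof.
move=> [s d] [s' d'] _ _; apply/permP=> x; rewrite permM.
apply: crown_coord_inj; rewrite ?w_crown_perm ?c_crown_perm ?t_crown_perm /=.
- by rewrite permM.
- by rewrite addrA.
- by rewrite !addr0.
Qed.
Canonical lift_base_morphism := Morphism lift_baseM.

Lemma injm_lift_base : 'injm lift_base_morphism.
Proof.
apply/injmP=> -[s d] [s' d'] _ _ /permP h; congr (_, _).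
  apply/permP=> i; have := congr1 w (h (g i 0%R 0%R)).
  by rewrite !w_crown_perm wg.
have i0 : 'I_m by exact: (Ordinal (ltnW (ltnW m_ge3))).
have := congr1 c (h (g i0 0%R 0%R)).
by rewrite !c_crown_perm cg /= !add0r.
Qed.

(* A numbering of the pairs of twins, so that swaps become row vectors. *)
Variables (n : nat) (k : 'I_m * 'Z_2 -> 'I_n) (k' : 'I_n -> 'I_m * 'Z_2).
Hypotheses (kK : cancel k k') (k'K : cancel k' k).

Definition shift_fibres (v : 'rV['Z_2]_n) : {perm T} :=
  crown_perm 1 0%R (fun i d => v 0%R (k (i, d))).

Lemma shift_fibresM :
  {in [set: 'rV['Z_2]_n] &, {morph shift_fibres : u v / u * v}}.
Proof.
move=> u v _ _; apply/permP=> x; rewrite permM.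
apply: crown_coord_inj; rewrite ?w_crown_perm ?c_crown_perm ?t_crown_perm /=.
- by rewrite !perm1.
- by rewrite !addr0.
- by rewrite w_crown_perm c_crown_perm perm1 addr0 -addrA mxE.
Qed.
Canonical shift_fibres_morphism := Morphism shift_fibresM.

Lemma injm_shift_fibres : 'injm shift_fibres_morphism.
Proof.
apply/injmP=> u v _ _ /permP h; apply/rowP=> j.
have := congr1 t (h (g (k' j).1 (k' j).2 0%R)).
by rewrite !t_crown_perm wg cg -surjective_pairing k'K tg !add0r.
Qed.

(** A permutation fixing indices and sides acts on each pair of twins; by
injectivity it shifts both levels of the pair by the same amount, which can
therefore be read off at the twin of level 0. *)
Lemma im_shift_fibres : shift_fibres @* [set: 'rV['Z_2]_n] = fibre_group.
Proof.
apply/setP=> s; apply/morphimP/fibre_groupP=> [[v _ _ ->] x | sN].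
  by rewrite w_crown_perm c_crown_perm perm1 addr0.
pose v := (\row_j t (s (g (k' j).1 (k' j).2 0)))%R.
exists v => //; apply/permP=> x.
have [wsx csx] := sN x.
apply: crown_coord_inj; rewrite ?w_crown_perm ?c_crown_perm ?t_crown_perm.
- by rewrite perm1.
- by rewrite addr0.
rewrite mxE kK /=; set x0 := g _ _ _.
have [tx0 | tx0] := eqVneq (t x) 0%R.
  by rewrite tx0 add0r /x0 -tx0 gK.
rewrite eq_sym in tx0; rewrite (Z2_neq tx0) add0r addrC.
apply: Z2_neq; apply: contraNneq tx0 => tsx.
have [wsx0 csx0] := sN x0.
have : s x0 = s x.
  by apply: crown_coord_inj => //; rewrite ?wsx ?csx ?wsx0 ?csx0 ?wg ?cg.
by move/perm_inj=> <-; rewrite tg.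
Qed.

(** An automorphism induces a permutation of the indices and a translation of
the sides; dividing by the lift that keeps all levels leaves a permutation
fixing indices and sides. *)
Lemma graph_aut_sdprod :
  shift_fibres @* [set: 'rV['Z_2]_n]
    ><| lift_base @* [set: 'S_m * 'Z_2] = graph_aut e.
Proof.
rewrite sdprodE; last 2 first.
- rewrite /= im_shift_fibres; apply/subsetP=> _ /morphimP[sd _ _ ->].
  have /graph_aut_crown[cs ws] := crown_perm_aut sd.1 sd.2 (fun _ _ => 0%R).
  rewrite inE; apply/subsetP=> _ /imsetP[s /fibre_groupP sN ->].
  apply/fibre_groupP=> x; rewrite -[x](permKV (lift_base sd)).
  rewrite permJ; have [wy cy] := sN ((lift_base sd)^-1 x).
  by split; apply/eqP; rewrite ?ws ?cs ?wy ?cy.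
- apply/trivgP/subsetP=> s /setIP[].
  rewrite /= im_shift_fibres => /fibre_groupP sN /morphimP[sd _ _ es].
  apply/set1P/permP=> x; rewrite perm1; have [wx cx] := sN x.
  by apply: crown_coord_inj; rewrite // es t_crown_perm addr0.
rewrite /= im_shift_fibres; apply/setP=> s.
apply/mulsgP/idP=> [[u _ /fibre_groupP uN /morphimP[sd _ _ ->] ->] | sA].
  rewrite groupM ?crown_perm_aut //.
  apply/graph_autP=> x y; have [wx cx] := uN x; have [wy cy] := uN y.
  by rewrite !eE wx cx wy cy.
have [cs ws] := graph_aut_crown sA.
(* Any side and level would do to read off the action on the indices. *)
have r_inj : injective (fun i => w (s (g i 0%R 0%R))).
  by move=> i j /eqP; rewrite ws !wg => /eqP.
pose i0 : 'I_m := Ordinal (ltnW (ltnW m_ge3)).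
pose d := c (s (g i0 0%R 0%R)).
have rE x : w (s x) = perm r_inj (w x).
  by apply/eqP; rewrite permE ws wg.
have dE x : c (s x) = (c x + d)%R.
  have [cx | cx] := eqVneq (c x) 0%R.
    by rewrite cx add0r; apply/eqP; rewrite cs cg cx.
  rewrite eq_sym in cx; rewrite (Z2_neq cx) add0r addrC.
  by apply: Z2_neq; rewrite cs cg.
pose l := lift_base (perm r_inj, d).
exists (s * l^-1) l; rewrite ?mulgKV //;
  last by apply: mem_morphim; rewrite inE.
apply/fibre_groupP=> x.
have lw y : w (l y) = perm r_inj (w y) by rewrite w_crown_perm.
have lc y : c (l y) = (c y + d)%R by rewrite c_crown_perm.
have hx : l ((s * l^-1) x) = s x by rewrite permM permKV.
split.
  by apply: (@perm_inj _ (perm r_inj)); rewrite -lw hx rE.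
by apply: (addIr d); rewrite -lc hx dE.
Qed.

Lemma graph_aut_extension :
  is_extension [set: 'rV['Z_2]_n]%G [set: 'S_m * 'Z_2]%G (graph_aut_group e).
Proof.
exists (shift_fibres @* [set: 'rV['Z_2]_n])%G.
have defA := graph_aut_sdprod.
have [nN _ _ _ _] := sdprod_context defA.
split=> //.
  by rewrite isog_sym; apply: (sub_isog (subxx _) injm_shift_fibres).
rewrite isog_sym; apply: isog_trans (sdprod_isog defA).
exact: (sub_isog (subxx _) injm_lift_base).
Qed.

End BlownUpCrown.

(** The form in which the results are applied: an injective system of
coordinates is bijective as soon as the cardinals agree. *)
Lemma crown_coordinates_graph (m n : nat) (T : finType) (e : rel T)
    (h : T -> 'I_m * 'Z_2 * 'Z_2) :
    injective h -> #|T| = (4 * m)%N -> n = (2 * m)%N -> 2 < m ->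
    (forall x y,
      e x y = ((h x).1.1 != (h y).1.1) && ((h x).1.2 != (h y).1.2)) ->
  [/\ connected_graph e, arc_transitive e
    & is_extension [set: 'rV['Z_2]_n]%G [set: 'S_m * 'Z_2]%G
        (graph_aut_group e)].
Proof.
move=> h_inj cardT def_n m_ge3 eE.
have [h' hK h'K] : bijective h.
  apply: inj_card_bij h_inj _.
  by rewrite !card_prod !card_ord cardT /Zp_trunc /=; lia.
have card_k : #|{: 'I_m * 'Z_2}| = n.
  by rewrite card_prod !card_ord def_n /Zp_trunc /=; lia.
have gK x : h' ((h x).1.1, (h x).1.2, (h x).2) = x.
  by rewrite -!surjective_pairing hK.
pose k ic := cast_ord card_k (enum_rank ic).
pose k' j := enum_val (cast_ord (esym card_k) j) : 'I_m * 'Z_2.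
have kK : cancel k k' by move=> ic; rewrite /k' /k cast_ordK enum_rankK.
have k'K : cancel k' k by move=> j; rewrite /k' /k enum_valK cast_ordKV.
have wg i d u : (h (h' (i, d, u))).1.1 = i by rewrite h'K.
have cg i d u : (h (h' (i, d, u))).1.2 = d by rewrite h'K.
have tg i d u : (h (h' (i, d, u))).2 = u by rewrite h'K.
split.
- exact: (crown_connected (w := fun x => (h x).1.1) (c := fun x => (h x).1.2)
            (g := fun i d u => h' (i, d, u))).
- exact: (crown_arc_transitive (w := fun x => (h x).1.1)
            (c := fun x => (h x).1.2) (t := fun x => (h x).2)
            (g := fun i d u => h' (i, d, u))).
- exact: (graph_aut_extension (w := fun x => (h x).1.1)
            (c := fun x => (h x).1.2) (t := fun x => (h x).2)
            (g := fun i d u => h' (i, d, u)) gK wg cg tg eE m_ge3 kK k'K).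
Qed.

Lemma inner_automorphic_normal (gT : finGroupType) (S : {set gT}) :
  (forall x y, x \in S -> x ^ y \in S) -> inner_automorphic S.
Proof.
move=> SJ; exists [set x ^: [set: gT] | x in S].
  by apply/subsetP=> _ /imsetP[x _ ->]; apply: mem_classes.
apply/setP=> x; apply/idP/bigcupP=> [xS | [_ /imsetP[y yS ->]]].
  by exists (x ^: [set: gT]); [apply: imset_f | apply: class_refl].
by case/imsetP=> z _ ->; apply: SJ.
Qed.

Lemma isog_dihedral (gT : finGroupType) (G : {group gT}) q :
  1 < q -> G \isog Grp (x : y : x ^+ q, y ^+ 2, x ^ y = x^-1) ->
  G \isog 'D_(q.*2).
Proof.
move=> q_gt1 G_pres; rewrite isogEhom Grp_dihedral // isoGrp_hom //=.
by rewrite G_pres isoGrp_hom //; apply: Grp_dihedral.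
Qed.

(** * Computing in dihedral groups *)

Section DihedralElements.

Variables (N : nat) (gT : finGroupType) (a b : gT).
Hypothesis N_gt0 : 0 < N.
Hypothesis hgen : <<[set a; b]>> = [set: gT].
Hypotheses (ha : a ^+ N = 1) (hb : b ^+ 2 = 1) (hab : a ^ b = a^-1).

Definition dih (i : nat) (j : bool) := a ^+ i * b ^+ j.

Lemma dihedral_gen_mul : <[a]> * <[b]> = [set: gT].
Proof.
rewrite -norm_joinEr -?hgen; last first.
  by rewrite cycle_subG inE -cycleJ hab cycleV.
by rewrite /cycle joing_idl joing_idr.
Qed.

Lemma dih_mod i j : dih (i %% N) j = dih i j.
Proof. by rewrite /dih expg_mod. Qed.

Lemma dih_surj x : exists ij : 'I_N * bool, dih ij.1 ij.2 = x.
Proof.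
have : x \in <[a]> * <[b]> by rewrite dihedral_gen_mul inE.
case/mulsgP=> _ _ /cycleP[i ->] /cycleP[j ->] ->.
exists (Ordinal (ltn_pmod i N_gt0), odd j); rewrite dih_mod /dih.
by rewrite -[in RHS](expg_mod _ hb) modn2.
Qed.

Lemma mulbb : b * b = 1. Proof. exact: hb. Qed.

Lemma mul_b_expa i : b * a ^+ i = (a ^+ i)^-1 * b.
Proof.
have bV : b^-1 = b by apply/eqP; rewrite eq_invg_mul mulbb.
by rewrite -expgVn -hab -conjXg conjgE bV -!mulgA mulbb mulg1.
Qed.

Lemma expaV i : (a ^+ i)^-1 = a ^+ (N.-1 * i)%N.
Proof.
apply/eqP; rewrite eq_invg_mul -expgD -mulSn prednK //.
by rewrite expgM ha expg1n.
Qed.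

Lemma dihM i j k l :
  dih i j * dih k l = dih (i + (if j then N.-1 * k else k))%N (j (+) l).
Proof.
rewrite /dih -mulgA expgD -[RHS]mulgA; congr (_ * _).
case: j; last by rewrite mul1g.
rewrite -expaV mulgA mul_b_expa -mulgA; congr (_ * _).
by case: l; rewrite ?mulg1 // mulbb.
Qed.

Lemma dihV i j : (dih i j)^-1 = dih (if j then i else N.-1 * i)%N j.
Proof.
case: j; last by rewrite /dih !mulg1 expaV.
apply/eqP; rewrite eq_invg_mul dihM /= /dih expgD -expaV.
by rewrite mulg1 mulgV.
Qed.

Hypothesis oG : #|gT| = (2 * N)%N.

(** The group is the product of the cyclic groups generated by [a] and [b], so
its order leaves no room for [a] to have order less than [N]. *)
Lemma order_rotation : #[a] = N.
Proof.
have := mul_cardG <[a]> <[b]>; rewrite dihedral_gen_mul cardsT oG.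
rewrite -[#|<[a]>|]/#[a] -[#|<[b]>|]/#[b].
have /(dvdn_leq N_gt0) : #[a] %| N by rewrite order_dvdn ha.
have /(dvdn_leq (isT : 0 < 2)) : #[b] %| 2 by rewrite order_dvdn hb.
have := cardG_gt0 (<[a]> :&: <[b]>)%G => /=.
by move: #[a] #[b] #|_| => x y z; nia.
Qed.

Lemma reflection_notin_rotations : b \notin <[a]>.
Proof.
apply/negP; rewrite -cycle_subG => /mulGSid ab.
by have := dihedral_gen_mul; rewrite ab => /(congr1 (fun A : {set gT} => #|A|));
   rewrite cardsT oG -[#|_|]/#[a] order_rotation; lia.
Qed.

Lemma dih_eq i j k l : (dih i j == dih k l) = (i == k %[mod N]) && (j == l).
Proof.
have bNa q r : a ^+ q != a ^+ r * b.
  apply: contra reflection_notin_rotations => /eqP ab.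
  by rewrite -(mulKg (a ^+ r) b) -ab groupM ?groupV ?mem_cycle.
rewrite -order_rotation -eq_expg_mod_order /dih.
case: j l => [] [] /=; rewrite ?andbT ?andbF ?mulg1.
- by rewrite (inj_eq (mulIg _)).
- by rewrite eq_sym; apply/negbTE/bNa.
- exact/negbTE/bNa.
- by [].
Qed.

Hypothesis N_even : ~~ odd N.

Lemma oddNp1 i : odd (N.-1 * i)%N = odd i.
Proof.
rewrite oddM; move: N_gt0 N_even.
by case: N => //= q _; rewrite negbK => ->.
Qed.

(** Conjugation by [a] changes the exponent of a reflection by 2, and
conjugation by [b] negates it; as [N] is even the parity is the only
invariant. *)
Lemma dih_reflection_class (pi : 'I_2) i j :
  (dih i j \in (a ^+ pi * b) ^: [set: gT]) = j && (odd i == odd pi).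
Proof.
apply/imsetP/andP=> [[x _] | [jt /eqP ipi]].
  have [[k l] /= <-] := dih_surj x.
  rewrite -[a ^+ pi * b]/(dih pi true) conjgE dihV !dihM => /eqP.
  rewrite dih_eq => /andP[ik jl]; split; first by rewrite (eqP jl); case: (l).
  have /(congr1 odd) := eqP ik.
  have odd_mod q : odd (q %% N) = odd q.
    by rewrite {2}(divn_eq q N) oddD oddM (negbTE N_even) andbF.
  rewrite !odd_mod => ->.
  by case: (l) => /=; rewrite !(oddD, oddNp1); case: (odd k); case: (odd pi).
rewrite jt; exists (a ^+ i./2)^-1; first by rewrite inE.
have bVa : b * (a ^+ i./2)^-1 = a ^+ i./2 * b.
  by apply: (mulIg (a ^+ i./2)); rewrite -!mulgA mul_b_expa mulVg mulg1 mulKVg.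
rewrite conjgE invgK -mulgA bVa /dih !mulgA -!expgD; congr (a ^+ _ * _).
rewrite -{1}(odd_double_half i) ipi.
by case: pi {ipi} => [[|[|//]] ?] /=; lia.
Qed.

Lemma coprime_opp i : coprime (N.-1 * i) N = coprime i N.
Proof. by rewrite coprimeMl coprimePn. Qed.

Lemma dih_connection_set (pi : 'I_2) i j :
  (dih i j \in dihedral_connection_set N a b pi) =
  if j then odd i == odd pi else coprime i N.
Proof.
rewrite inE dih_reflection_class; case: j => /=.
  rewrite orb_idr // => /imsetP[k _ /eqP].
  by rewrite -[a ^+ k]mulg1 -[a ^+ k * 1]/(dih k false) dih_eq andbF.
apply/imsetP/idP=> [[k] | co_i].
  rewrite inE => co_k /eqP; rewrite -[a ^+ k]mulg1 -[a ^+ k * 1]/(dih k false).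
  by rewrite dih_eq andbT => /eqP ik; rewrite -coprime_modl ik coprime_modl.
exists (Ordinal (ltn_pmod i N_gt0)); first by rewrite inE coprime_modl.
by rewrite -dih_mod /dih mulg1.
Qed.

Lemma dihedral_connection_setP (pi : 'I_2) :
  connection_set (dihedral_connection_set N a b pi).
Proof.
split.
  rewrite -[1]mulg1 -[1 * 1]/(dih 0 false) dih_connection_set /coprime gcd0n.
  by apply: contraNneq N_even => ->.
apply/setP=> x; rewrite inE; have [[i j] /= <-] := dih_surj x.
by rewrite dihV !dih_connection_set; case: j => //; apply: coprime_opp.
Qed.

Lemma dihedral_inner_automorphic (pi : 'I_2) :
  inner_automorphic (dihedral_connection_set N a b pi).
Proof.
apply: inner_automorphic_normal => x y.
have [[i j] /= <-] := dih_surj x; have [[k l] /= <-] := dih_surj y.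
rewrite dih_connection_set; case: j => [ipi | co_i].
  rewrite conjgE dihV !dihM dih_connection_set -(eqP ipi).
  by case: (l) => /=; rewrite !(oddD, oddNp1); case: (odd k); case: (odd i).
have -> : dih i false ^ dih k l = dih (if l then N.-1 * i else i)%N false.
  rewrite /dih !mulg1 conjgM [_ ^ (a ^+ k)]conjgE -expgD addnC expgD mulKg.
  by case: l; rewrite ?conjg1 //= conjXg hab expgVn expaV.
by rewrite dih_connection_set; case: l; rewrite ?coprime_opp.
Qed.

Lemma dih_adjacent (pi : 'I_2) i j k l :
  Cay (dihedral_connection_set N a b pi) (dih i j) (dih k l) =
  if j == l then coprime (k + N.-1 * i) N else odd (k + i) == odd pi.
Proof.
rewrite /Cay /= dihV dihM dih_connection_set.
by case: j l => [] [] //=; rewrite !(oddD, oddNp1).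
Qed.

End DihedralElements.

(** * The crown coordinates of a dihedral group of order 8p *)

Section CrownCoordinates.

Variables (p : nat) (pi : 'I_2).
Hypothesis p_pr : prime p.

Lemma crown_index_subproof i (j : bool) : i %% p + j * p < 2 * p.
Proof. by have := ltn_pmod i (prime_gt0 p_pr); case: j; lia. Qed.

(** The residue of [i] modulo [p] and the bit [j] together determine the coset
of [a^i b^j] modulo the subgroup generated by [a^p]. *)
Definition crown_index i j : 'I_(2 * p) := Ordinal (crown_index_subproof i j).

(** The character of the group with value 1 on both [a] and [a^pi b], hence on
the whole connection set. *)
Definition crown_side i (j : bool) : 'Z_2 := inZp (odd i (+) (~~ odd pi && j)).

(** Twins differ by the central involution [a^(2p)], that is by the half of the
range [0, 4p) in which the exponent lies. *)
Definition crown_level i : 'Z_2 := inZp (i %/ (2 * p)).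

Lemma inZp_bool (u v : bool) : (inZp u == inZp v :> 'Z_2) = (u == v).
Proof. by case: u v => [] []. Qed.

Lemma crown_index_eq i j k l :
  (crown_index i j == crown_index k l) = (i == k %[mod p]) && (j == l).
Proof.
rewrite -val_eqE /=.
have := ltn_pmod i (prime_gt0 p_pr); have := ltn_pmod k (prime_gt0 p_pr).
move: (i %% p) (k %% p) => x y.
by case: j l => [] [] /= hy hx; rewrite ?andbT ?andbF; apply/eqP/eqP; lia.
Qed.

(** The exponent on the left is [k - i] modulo [4p]. *)
Lemma coprime_difference i k :
  coprime (k + (4 * p).-1 * i) (4 * p) = (odd i != odd k) && (i != k %[mod p]).
Proof.
have p_gt0 := prime_gt0 p_pr.
rewrite coprimeMr -[4]/(2 ^ 2)%N coprime_pexpr // coprimen2; congr (_ && _).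
  have -> : (2 ^ 2 * p).-1 = (2 * (2 * p).-1).+1 by lia.
  by rewrite mulSn !oddD mul2n -doubleMl odd_double addbF; case: odd; case: odd.
rewrite coprime_sym prime_coprime //; congr (~~ _).
rewrite /dvdn -[X in _ == X](mod0n p) -[in LHS](eqn_modDr i) add0n.
have -> : k + (2 ^ 2 * p).-1 * i + i = 4 * i * p + k by nia.
by rewrite modnMDl eq_sym.
Qed.

Hypothesis p_odd : odd p.

(** As [p] is odd, side and index determine the exponent modulo [2p]. *)
Lemma crown_coord_bounded_inj i j k l :
    i < 4 * p -> k < 4 * p -> crown_index i j = crown_index k l ->
  crown_side i j = crown_side k l -> crown_level i = crown_level k ->
  i = k /\ j = l.
Proof.
move=> i_lt k_lt /eqP; rewrite crown_index_eq => /andP[ikp /eqP <-].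
move/eqP; rewrite inZp_bool (inj_eq (@addIb _)) => ik2.
have p_gt0 := prime_gt0 p_pr.
have level_lt2 q : q < 4 * p -> q %/ (2 * p) < 2.
  by move=> q_lt; rewrite ltn_divLR; lia.
move=> /(congr1 val) /=; rewrite !modn_small ?level_lt2 // => ikd.
have : i == k %[mod 2 * p].
  by rewrite chinese_remainder ?coprime2n // ikp andbT !modn2 (eqP ik2).
by move/eqP=> ikm; rewrite (divn_eq i (2 * p)) ikm ikd -divn_eq.
Qed.

End CrownCoordinates.

Theorem theorem1p4 (p : nat) (hp : prime p) (hodd : odd p)
    (gT : finGroupType) (a b : gT)
    (hgen : <<[set a; b]>> = [set: gT])
    (ha : a ^+ (4 * p) = 1) (hb : b ^+ 2 = 1) (hab : a ^ b = a^-1)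
    (hpres : [set: gT] \isog Grp (x : y : x ^+ (4 * p), y ^+ 2, x ^ y = x^-1))
    (pi : 'I_2) :
  let S := dihedral_connection_set (4 * p) a b pi in
  [set: gT] \isog 'D_(8 * p) /\
  [/\ connection_set S,
      connected_graph (Cay S),
      arc_transitive (Cay S),
      inner_automorphic S
    & is_extension [set: 'rV['Z_2]_(4 * p)]%G
        [set: 'S_(2 * p) * 'Z_2]%G
        (graph_aut_group (Cay S))].
Proof.
have p_gt2 := odd_prime_gt2 hodd hp.
have def8p : (8 * p = (4 * p).*2)%N by lia.
have N_gt1 : (1 < 4 * p)%N by lia.
have N_gt0 := ltnW N_gt1.
have N_even : ~~ odd (4 * p) by rewrite oddM.
have G_dih : [set: gT] \isog 'D_(8 * p).
  by rewrite def8p; apply: (isog_dihedral N_gt1 hpres).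
have oG : #|gT| = (2 * (4 * p))%N.
  by rewrite -cardsT (card_isog G_dih) def8p card_dihedral // mul2n.
move=> S; split=> //.
have [r rK] := fin_all_exists (dih_surj N_gt0 hgen ha hb hab).
pose h x := (crown_index hp (r x).1 (r x).2, crown_side pi (r x).1 (r x).2,
             crown_level p (r x).1).
have h_inj : injective h.
  move=> x y exy; have ew := congr1 (fun z => z.1.1) exy.
  have ec := congr1 (fun z => z.1.2) exy; have et := congr1 (fun z => z.2) exy.
  have [] := crown_coord_bounded_inj hodd (ltn_ord _) (ltn_ord _) ew ec et.
  by move=> e1 e2; rewrite -(rK x) -(rK y) e1 e2.
have eE x y : Cay S x y = ((h x).1.1 != (h y).1.1) && ((h x).1.2 != (h y).1.2).
  rewrite -[in LHS](rK x) -[in LHS](rK y) dih_adjacent //.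
  rewrite crown_index_eq inZp_bool coprime_difference //.
  move: (r x) (r y) => [i j] [k l] /=.
  have [<- | jl] := eqVneq j l.
    by rewrite andbT (inj_eq (@addIb _)) andbC.
  rewrite andbF /= oddD.
  by move: jl; case: j l => [] [] //=; case: odd; case: odd; case: odd.
have cardT : #|gT| = (4 * (2 * p))%N by rewrite oG; lia.
have def4p : (4 * p = 2 * (2 * p))%N by lia.
have m_ge3 : 2 < 2 * p by lia.
have [conn arc ext] := crown_coordinates_graph h_inj cardT def4p m_ge3 eE.
split=> //.
- exact: dihedral_connection_setP.
- exact: dihedral_inner_automorphic.
Qed.
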